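(* Let $\kappa$ be a regular uncountable cardinal and let $\mathbf k$ be an exponential field. Then there is a multiplicative ordered abelian group $G$ such that the field $\mathbb K=\mathbf k((G))_\kappa$ admits an omega-map $\omega:\mathbb K\to G$, i.e. an isomorphism of ordered groups $(\mathbb K,+,0,<)\cong(G,\cdot,1,<)$.
   Context: An exponential field is a real closed field $\mathbf k$ with an isomorphism of ordered groups $\exp:(\mathbf k,+,0,<)\cong(\mathbf k^{>0},\cdot,1,<)$. For an ordered field $\mathbf k$ and a multiplicative ordered abelian group $G$, the Hahn field $\mathbf k((G))$ consists of formal series $\sum_{g\in G} g\,r_g$ ($r_g\in\mathbf k$) with reverse well-ordered support $\{g:r_g\ne0\}$, componentwise addition, Cauchy product, ordered by the sign of the coefficient of the largest support element. For a regular uncountable cardinal $\kappa$, $\mathbf k((G))_\kappa$ is the subfield of series whose support has reverse order type $<\kappa$. In $\mathbf k((G))_\kappa$ the valuation ring is $\{x:|x|\le r\text{ for some }r\in\mathbf k\}$ and $G$ is the group of monomials (one representative of each class of the equivalence $x\asymp y$). *)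

(* Defs.v *)
From HB Require Import structures.
From mathcomp Require Import all_boot all_order all_algebra.
From mathcomp Require Import mathcomp_extra boolp classical_sets functions.
From mathcomp Require Import cardinality fsbigop.

Set Implicit Arguments.
Unset Strict Implicit.
Unset Printing Implicit Defensive.

Import Order.TTheory GRing.Theory Num.Theory.

Local Open Scope classical_set_scope.
Local Open Scope ring_scope.

(* A regular uncountable cardinal, as an ordinal (a well-ordered type) that is
   initial (not equipotent to any proper initial segment) and of which every
   cofinal subset has full cardinality, i.e., cf(kappa) = kappa. *)
HB.mixin Record isRegularUncountable (d : Order.disp_t) T of Order.Total d T := {
  wo_min : forall A : set T, A !=set0 ->
    exists2 a, A a & forall b, A b -> (a <= b)%O;
  initial_ordinal : forall a : T, ~ ([set: T] #<= [set b : T | (b < a)%O])%card;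
  regular_cofinality : forall A : set T,
    (forall b, exists2 a, A a & (b <= a)%O) -> (A #= [set: T])%card;
  uncountable : ~ countable [set: T];
}.

#[short(type="regCardType")]
HB.structure Definition RegCard (d : Order.disp_t) :=
  { T of Order.Total d T & isRegularUncountable d T }.

HB.mixin Record isOrderedAbelian (d : Order.disp_t) G
    of Group G & Order.Total d G := {
  omulgC : forall x y : G, (x * y = y * x)%g;
  oltgM2l : forall x y z : G, (y < z)%O -> ((x * y)%g < (x * z)%g)%O;
}.

#[short(type="ordAbGroupType")]
HB.structure Definition OrdAbGroup (d : Order.disp_t) :=
  { G of Group G & Order.Total d G & isOrderedAbelian d G }.

Section Cardinal.
Context {d : Order.disp_t} {kappa : regCardType d}.

(* By regularity, this holds for the sets of cardinality < kappa. *)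
Definition kbounded T (S : set T) :=
  forall h : T -> kappa, exists c, forall x, S x -> (h x < c)%O.

Lemma regcard_inh : exists a : kappa, True.
Proof.
apply: contrapT => /forallNP no; apply: (@uncountable d kappa).
suff -> : [set: kappa] = set0 by exact: countable0.
by apply/seteqP; split => // x _; apply: (no x).
Qed.

Lemma kbounded_sub T (A B : set T) : A `<=` B -> kbounded B -> kbounded A.
Proof. by move=> AB Bb h; have [c hc] := Bb h; exists c => x /AB/hc. Qed.

Lemma kboundedU T (A B : set T) :
  kbounded A -> kbounded B -> kbounded (A `|` B).
Proof.
move=> Ab Bb h; have [a ha] := Ab h; have [b hb] := Bb h.
by exists (Order.max a b) => x [/ha|/hb] lt; rewrite lt_max lt ?orbT.
Qed.

Lemma kbounded_image2 T U V (f : T -> U -> V) (A : set T) (B : set U) :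
  kbounded A -> kbounded B -> kbounded [set f a b | a in A & b in B].
Proof.
move=> Ab Bb h; have [g hg] := choice (fun a => Bb (fun b => h (f a b))).
have [c hc] := Ab g; exists c => _ [a Aa [b Bb' <-]].
exact: lt_trans (hg _ _ Bb') (hc _ Aa).
Qed.

End Cardinal.
Arguments kbounded {d} kappa {T} S.

Section Support.
Context {d' : Order.disp_t} {G : orderType d'}.
Context {d : Order.disp_t} (kappa : regCardType d).

Definition rev_well_ordered (S : set G) := forall A : set G,
  A `<=` S -> A !=set0 -> exists2 a, A a & forall b, A b -> (b <= a)%O.

(* S, ordered by >, is isomorphic to the ordinal {b | b < a} for some
   a < kappa; in particular S is reverse well-ordered. *)
Definition rev_otype_lt (S : set G) := exists (a : kappa) (f : G -> kappa),
  set_bij S [set b | (b < a)%O] f /\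
  forall x y, S x -> S y -> (f x < f y)%O = (y < x)%O.

Lemma rev_otype_lt_wo S : rev_otype_lt S -> rev_well_ordered S.
Proof.
move=> [a [f [_ fm]]] A AS [x Ax].
have [_ [m Am <-] mmin] := @wo_min d kappa (f @` A) (ex_intro _ _ (imageP f Ax)).
exists m => // b Ab; rewrite leNgt -fm; try exact: AS.
by rewrite -leNgt mmin //; apply: imageP.
Qed.

Lemma rev_otype_lt_kbounded S : rev_otype_lt S -> kbounded kappa S.
Proof.
move=> [a [f [[fS finj _] _]]] h; apply: contrapT => /forallNP nb.
apply: (@initial_ordinal d kappa a).
have cof : forall b, exists2 c, (h @` S) c & (b <= c)%O.
  move=> b; have /existsNP[x /not_implyP[Sx /negP]] := nb b.
  by rewrite -leNgt => le; exists (h x) => //; apply: imageP.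
have /card_eqPle[_ le1] := regular_cofinality _ cof.
apply: card_le_trans le1 _; apply: card_le_trans (card_image_le _ _) _.
have /card_eqPle[_ le2] := inj_card_eq finj.
apply: card_le_trans le2 _; apply: subset_card_le => _ [x Sx <-].
exact: fS.
Qed.

Lemma rev_otype_ltI S :
  rev_well_ordered S -> kbounded kappa S -> rev_otype_lt S.
Proof.
move=> wS bS; pose R (t s : G) := S t /\ (s < t)%O.
have wfR : well_founded R.
  move=> s; have acc t : S t -> Acc R t.
    move=> St; apply: contrapT => nA.
    have [||m [Sm nAm] mmax] := wS [set u | S u /\ ~ Acc R u]; first by move=> u [].
      by exists t.
    apply: nAm; constructor => u [Su lt]; apply: contrapT => nAu.
    by have := mmax u (conj Su nAu); rewrite leNgt lt.
  by constructor => t [St _]; apply: acc.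
have [c0 _] := @regcard_inh d kappa.
pose lub (A : set kappa) := xget c0 [set c |
  (forall b, A b -> b < c)%O /\ forall c', (forall b, A b -> b < c')%O -> (c <= c')%O].
pose F s (rec : forall t, R t s -> kappa) :=
  lub [set c | exists t, exists r : R t s, c = rec t r].
pose h := Fix wfR (fun=> kappa) F.
have hE s : h s = lub [set c | exists2 t, R t s & c = h t].
  rewrite /h Fix_eq -/h; last first.
    move=> x f g fg; rewrite /F; congr lub; apply/seteqP.
    by split=> c [t [r ->]]; exists t, r; rewrite fg.
  rewrite /F; congr lub; apply/seteqP.
  by split=> c; [move=> [t [r ->]]; exists t|move=> [t r ->]; exists t, r].
have lubP (A : set kappa) : A `<=` h @` S ->
   (forall b, A b -> b < lub A)%O /\
   forall c', (forall b, A b -> b < c')%O -> (lub A <= c')%O.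
  move=> AhS; have [c hc] := bS h.
  have [|m mA mmin] := @wo_min d kappa [set c | forall b, A b -> (b < c)%O].
    by exists c => b /AhS[x Sx <-]; apply: hc.
  exact: (xgetPex c0 (ex_intro [set c | (forall b, A b -> b < c)%O /\
    forall c', (forall b, A b -> b < c')%O -> (c <= c')%O] m (conj mA mmin))).
have hlt s t : R t s -> (h t < h s)%O.
  move=> r; rewrite (hE s); have [|ub _] := lubP [set c | exists2 t, R t s & c = h t].
    by move=> _ [u [Su _] ->]; apply: imageP.
  by apply: ub; exists t.
have [aub amin] := lubP (h @` S) (fun _ => id).
have hdown s c : (c < h s)%O -> exists2 t, S t & h t = c.
  elim/(well_founded_ind wfR): s => s IH lt.
  have [|_ hmin] := lubP [set c | exists2 t, R t s & c = h t].
    by move=> _ [u [Su _] ->]; apply: imageP.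
  have : ~ (h s <= c)%O by rewrite leNgt lt.
  rewrite (hE s) => /(contra_not (hmin c))/existsNP[_ /not_implyP[[t r ->]]].
  move=> /negP; rewrite -leNgt le_eqVlt => /orP[/eqP->|]; last exact: IH.
  by exists t => //; case: r.
have hm x y : S x -> S y -> (h x < h y)%O = (y < x)%O.
  move=> Sx Sy; case: (ltgtP y x) => [lt|lt|->]; last by rewrite ltxx.
    exact: hlt.
  by apply/negbTE; rewrite -leNgt ltW //; apply: hlt.
exists (lub (h @` S)), h; split => //; split.
- by move=> x Sx; apply: aub; apply: imageP.
- move=> x y; rewrite !inE => Sx Sy e.
  by apply/eqP; case: (ltgtP x y) => // lt; move: (lt); rewrite -hm // e ltxx.
- move=> c /= lt.
  have : ~ (lub (h @` S) <= c)%O by rewrite leNgt lt.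
  move=> /(contra_not (amin c))/existsNP[_ /not_implyP[[s Ss <-]]].
  move=> /negP; rewrite -leNgt le_eqVlt => /orP[/eqP->|/hdown//].
  by exists s.
Qed.

Lemma rev_well_ordered_sub (A B : set G) :
  A `<=` B -> rev_well_ordered B -> rev_well_ordered A.
Proof. by move=> AB wB C CA; apply: wB => x /CA/AB. Qed.

Lemma rev_well_orderedU (A B : set G) :
  rev_well_ordered A -> rev_well_ordered B -> rev_well_ordered (A `|` B).
Proof.
move=> wA wB C CAB [x Cx].
have [[a [Aa Ca]]|nA] := pselect (exists a, A a /\ C a); last first.
  by apply: wB; [move=> y Cy; case: (CAB y Cy) => // Ay; case: nA; exists y|exists x].
have [[b [Bb Cb]]|nB] := pselect (exists b, B b /\ C b); last first.
  by apply: wA; [move=> y Cy; case: (CAB y Cy) => // By; case: nB; exists y|exists x].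
have [||m [Am Cm] mmax] := wA (A `&` C); [by move=> ? []|by exists a|].
have [||n [Bn Cn] nmax] := wB (B `&` C); [by move=> ? []|by exists b|].
have [mn|nm] := leP m n.
  exists n => // y Cy; case: (CAB y Cy) => ?; last exact: nmax.
  by apply: le_trans mn; apply: mmax.
exists m => // y Cy; case: (CAB y Cy) => ?; first exact: mmax.
by apply: le_trans (ltW nm); apply: nmax.
Qed.

Lemma rev_otype_lt_sub (A B : set G) :
  A `<=` B -> rev_otype_lt B -> rev_otype_lt A.
Proof.
move=> AB oB; apply: rev_otype_ltI.
  exact: rev_well_ordered_sub AB (rev_otype_lt_wo oB).
exact: kbounded_sub AB (rev_otype_lt_kbounded oB).
Qed.

Lemma rev_otype_ltU (A B : set G) :
  rev_otype_lt A -> rev_otype_lt B -> rev_otype_lt (A `|` B).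
Proof.
move=> oA oB; apply: rev_otype_ltI.
  exact: rev_well_orderedU (rev_otype_lt_wo oA) (rev_otype_lt_wo oB).
exact: kboundedU (rev_otype_lt_kbounded oA) (rev_otype_lt_kbounded oB).
Qed.

Lemma rev_otype_lt0 : rev_otype_lt set0.
Proof.
apply: rev_otype_ltI; first by move=> A A0 [x /A0].
by move=> h; have [c _] := @regcard_inh d kappa; exists c.
Qed.

End Support.

Section HahnProduct.
Context {d' : Order.disp_t} {G : ordAbGroupType d'}.
Implicit Types (A B : set G) (x y z : G).

Lemma oltgM2lE x y z : ((x * y)%g < (x * z)%g)%O = (y < z)%O.
Proof.
case: (ltgtP y z) => [/oltgM2l->//|/oltgM2l lt|->]; last by rewrite ltxx.
by apply/negbTE; rewrite -leNgt ltW.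
Qed.

Lemma olegM2lE x y z : ((x * y)%g <= (x * z)%g)%O = (y <= z)%O.
Proof. by rewrite !leNgt oltgM2lE. Qed.

Lemma oltgM2rE x y z : ((y * x)%g < (z * x)%g)%O = (y < z)%O.
Proof. by rewrite ![(_ * x)%g]omulgC oltgM2lE. Qed.

Lemma olegM2rE x y z : ((y * x)%g <= (z * x)%g)%O = (y <= z)%O.
Proof. by rewrite !leNgt oltgM2rE. Qed.

Lemma rev_well_orderedM A B : rev_well_ordered A -> rev_well_ordered B ->
  rev_well_ordered [set (a * b)%g | a in A & b in B].
Proof.
move=> wA wB C CAB [_ /[dup] /CAB[a0 Aa0 [b0 Bb0 <-]] C0].
pose rec a b := [/\ A a, B b, C (a * b)%g & forall a' b', A a' -> B b' ->
  C (a' * b')%g -> ((a * b)%g <= (a' * b')%g)%O -> (a' <= a)%O].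
have ex_rec (P : set G) : (forall u v, P u -> (u <= v)%O -> P v) ->
    (exists a b, [/\ A a, B b, C (a * b)%g & P (a * b)%g]) ->
    exists a b, rec a b /\ P (a * b)%g.
  move=> up [a [b [Aa Bb Cab Pab]]].
  have [||a1 [Aa1 [b1 [Bb1 C1 P1]]] a1max] := wA
    [set a | A a /\ exists b, [/\ B b, C (a * b)%g & P (a * b)%g]].
  - by move=> ? [].
  - by exists a; split=> //; exists b.
  exists a1, b1; split=> //; split=> // a' b' Aa' Bb' Cab' le.
  by apply: a1max; split=> //; exists b'; split=> //; apply: up le.
have [a1 [b1 [r1 _]]] : exists a b, rec a b /\ setT (a * b)%g.
  by apply: ex_rec => //; exists a0, b0.
have [||b [a rab] bmax] := wB [set b | exists a, rec a b].
- by move=> b [a []].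
- by exists b1, a1.
have [Aa Bb Cab amax] := rab.
exists (a * b)%g => // c Cc; rewrite leNgt; apply/negP => lt.
have [a' Aa' [b' Bb' ec]] := CAB _ Cc.
have [a2 [b2 [r2 lt2]]] :
    exists a2 b2, rec a2 b2 /\ ((a * b)%g < (a2 * b2)%g)%O.
  apply: (ex_rec (fun u => ((a * b)%g < u)%O)); first by move=> u v /= lt1; apply: lt_le_trans.
  by exists a', b'; rewrite ec.
have [Aa2 Bb2 C2 _] := r2.
have le1 := amax _ _ Aa2 Bb2 C2 (ltW lt2).
have le2 : (b2 <= b)%O by apply: bmax; exists a2.
move: lt2; rewrite ltNge => /negP; apply.
apply: (@le_trans _ _ (a * b2)%g); first by rewrite olegM2rE.
by rewrite olegM2lE.
Qed.

Context {d : Order.disp_t} (kappa : regCardType d).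

Lemma rev_otype_ltM A B : rev_otype_lt kappa A -> rev_otype_lt kappa B ->
  rev_otype_lt kappa [set (a * b)%g | a in A & b in B].
Proof.
move=> oA oB; apply: rev_otype_ltI.
  exact: rev_well_orderedM (rev_otype_lt_wo oA) (rev_otype_lt_wo oB).
exact: kbounded_image2 (rev_otype_lt_kbounded oA) (rev_otype_lt_kbounded oB).
Qed.

End HahnProduct.

Section Hahn.
Context (k : rcfType) {d' : Order.disp_t} (G : ordAbGroupType d').
Context {d : Order.disp_t} (kappa : regCardType d).

Definition hahn_supp (f : G -> k) : set G := [set g | f g != 0].

Definition hahn_pred : {pred G -> k} :=
  fun f => `[< rev_otype_lt kappa (hahn_supp f) >].

(* The carrier of k((G))_kappa. *)
Record hahn := Hahn { hcoef :> G -> k ; _ : hcoef \in hahn_pred }.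

HB.instance Definition _ := [isSub for hcoef].
HB.instance Definition _ := [Choice of hahn by <:].

Fact hahn_zmod_closed : zmod_closed hahn_pred.
Proof.
split=> [|f g /asboolP of_ /asboolP og]; apply/asboolP.
  apply: rev_otype_lt_sub (rev_otype_lt0 _) => x.
  by rewrite /hahn_supp /= eqxx.
apply: rev_otype_lt_sub (rev_otype_ltU of_ og) => x.
rewrite /hahn_supp /=; have [f0|] := eqVneq (f x) 0; last by left.
by move=> fg; right; move: fg; rewrite -[_ x]/(f x - g x) f0 add0r oppr_eq0.
Qed.

HB.instance Definition _ := GRing.isZmodClosed.Build _ _ hahn_zmod_closed.
HB.instance Definition _ := [SubChoice_isSubZmodule of hahn by <:].

(* The coefficient of the largest element of the support is positive. *)
Definition hahn_pos (x : hahn) :=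
  exists2 g, 0 < x g & forall h, (g < h)%O -> x h = 0.

Definition hahn_lt : rel hahn := fun x y => `[< hahn_pos (y - x) >].

Lemma hahn_wo (x : hahn) : rev_well_ordered (hahn_supp x).
Proof. by case: x => f /= /asboolP; apply: rev_otype_lt_wo. Qed.

Lemma hahnD (x y : hahn) g : (x + y) g = x g + y g. Proof. by []. Qed.
Lemma hahnN (x : hahn) g : (- x) g = - x g. Proof. by []. Qed.
Lemma hahn0 g : (0 : hahn) g = 0. Proof. by []. Qed.

Lemma hahnP (x y : hahn) : (forall g, x g = y g) -> x = y.
Proof. by move=> e; apply: val_inj; apply/funext. Qed.

Lemma hahn_posD (x y : hahn) : hahn_pos x -> hahn_pos y -> hahn_pos (x + y).
Proof.
move=> [g g0 gm] [h h0 hm]; case: (ltgtP g h) => [lt|lt|e].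
- exists h => [|u lu]; rewrite hahnD; first by rewrite gm // add0r.
  by rewrite hm // gm ?addr0 // (lt_trans lt).
- exists g => [|u lu]; rewrite hahnD; first by rewrite hm // addr0.
  by rewrite gm // hm ?addr0 // (lt_trans lt).
- subst h; exists g => [|u lu]; rewrite hahnD; first exact: addr_gt0.
  by rewrite gm // hm ?addr0.
Qed.

Lemma hahn_pos0 : ~ hahn_pos 0.
Proof. by case=> g; rewrite hahn0 ltxx. Qed.

Lemma hahn_pos_total (x : hahn) : x != 0 -> hahn_pos x \/ hahn_pos (- x).
Proof.
move=> x0; have [||g /= gs gm] := @hahn_wo x (hahn_supp x) => //.
  apply: contrapT => /forallNP s0; case/eqP: x0; apply: hahnP => g.
  by rewrite hahn0; apply/eqP; rewrite -[_ == _]negbK; apply/negP/s0.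
have z h : (g < h)%O -> x h = 0.
  move=> lt; apply/eqP; rewrite -[_ == _]negbK; apply/negP => /gm.
  by rewrite leNgt lt.
move: gs; rewrite /hahn_supp /= neq_lt => /orP[lt|lt]; [right|left]; exists g => //.
  by rewrite hahnN oppr_gt0.
by move=> h lh; rewrite hahnN z // oppr0.
Qed.

Fact hahn_lt_irr : irreflexive hahn_lt.
Proof. by move=> x; apply/negbTE/asboolP; rewrite subrr; apply: hahn_pos0. Qed.

Fact hahn_lt_trans : transitive hahn_lt.
Proof.
move=> y x z /asboolP xy /asboolP yz; apply/asboolP.
by rewrite -(subrKA y); apply: hahn_posD.
Qed.

HB.instance Definition _ :=
  Order.Lt_isPOrder.Build ring_display hahn hahn_lt_irr hahn_lt_trans.

Lemma hahn_ltE (x y : hahn) : (x < y) = `[< hahn_pos (y - x) >].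
Proof. by []. Qed.

Fact hahn_le_total : total (<=%R : rel hahn).
Proof.
move=> x y; rewrite !le_eqVlt; have [->|ne] := eqVneq x y; first by [].
rewrite /=; apply/orP; have := @hahn_pos_total (y - x).
rewrite subr_eq0 eq_sym opprB => /(_ ne)[p|p]; [left|right]; exact/asboolP.
Qed.

HB.instance Definition _ :=
  Order.POrder_isTotal.Build ring_display hahn hahn_le_total.

Lemma hahn_ltD2l (x y z : hahn) : (x + y < x + z) = (y < z).
Proof. by rewrite !hahn_ltE opprD addrACA subrr add0r. Qed.

Lemma hahn_mul_finite (x y : hahn) (g : G) :
  finite_set [set a | hahn_supp x a /\ hahn_supp y (a^-1 * g)%g].
Proof.
set D := [set _ | _]; apply: contrapT => infD.
have wo (A : set G) : A `<=` D -> A !=set0 ->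
    exists2 a, A a & forall b, A b -> (a <= b)%O.
  move=> AD [a0 Aa0].
  have [||_ [a Aa <-] amax] := @hahn_wo y [set (a^-1 * g)%g | a in A].
  - by move=> _ [a /AD[_ ?] <-].
  - by exists (a0^-1 * g)%g, a0.
  exists a => // b Ab; have := amax _ (imageP _ Ab).
  rewrite olegM2rE -(olegM2lE a) mulgV -(olegM2rE b _ 1%g) mul1g.
  by rewrite -mulgA mulVg mulg1.
have rwo (A : set G) : A `<=` D -> A !=set0 ->
    exists2 a, A a & forall b, A b -> (b <= a)%O.
  by move=> AD; apply: (@hahn_wo x) => a /AD[].
pose Q := [set a | D a /\ infinite_set [set b | D b /\ (a <= b)%O]].
have Q0 : Q !=set0.
  apply: contrapT => noQ; have [||m Dm mmin] := wo D; first by [].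
    by apply: contrapT => D0; apply: infD; rewrite (_ : D = set0) //;
      apply/seteqP; split=> // a Da; apply: D0; exists a.
  apply: noQ; exists m; split=> //; apply: contra_not infD.
  by apply: sub_finite_set => a Da; split=> //; apply: mmin.
have [q [Dq infq] qmax] : exists2 a, Q a & forall b, Q b -> (b <= a)%O.
  by apply: rwo => // a [].
have [[u [Du qu]]|no] := pselect (exists u, D u /\ (q < u)%O); last first.
  apply: infq; apply: sub_finite_set (finite_set1 q) => b [Db].
  by rewrite le_eqVlt => /orP[/eqP->//|lt]; case: no; exists b.
have [||m [Dm qm] mmin] := wo [set b | D b /\ (q < b)%O].
- by move=> b [].
- by exists u.
have fm : finite_set [set b | D b /\ (m <= b)%O].
  by apply: contrapT => nf; have := qmax m (conj Dm nf); rewrite leNgt qm.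
apply: infq; apply: (@sub_finite_set _ _ ([set q] `|` [set b | D b /\ (m <= b)%O])).
  move=> b [Db]; rewrite le_eqVlt => /orP[/eqP->|lt]; [by left|right].
  by split=> //; apply: mmin.
by rewrite finite_setU; split=> //; apply: finite_set1.
Qed.

(* Cauchy product: the sum over the factorizations g = a * b, of which only
   finitely many contribute. *)
Definition hahn_mul_fun (x y : hahn) (g : G) : k :=
  \sum_(a \in hahn_supp x) x a * y (a^-1 * g)%g.

Fact hahn_mul_subproof (x y : hahn) : hahn_mul_fun x y \in hahn_pred.
Proof.
have [of_ og] : rev_otype_lt kappa (hahn_supp x) /\ rev_otype_lt kappa (hahn_supp y).
  by case: x => x /= /asboolP ?; case: y => y /= /asboolP ?.
apply/asboolP; apply: rev_otype_lt_sub (rev_otype_ltM of_ og) => g.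
rewrite /hahn_supp /= => nz; apply: contrapT => no; move/eqP: nz; apply.
apply: fsbig1 => a /= xa; have [->|yb] := eqVneq (y (a^-1 * g)%g) 0.
  by rewrite mulr0.
by case: no; exists a => //; exists (a^-1 * g)%g => //; rewrite mulgA mulgV mul1g.
Qed.

Definition hahn_mul (x y : hahn) : hahn := Hahn (hahn_mul_subproof x y).

End Hahn.

(* exp is an isomorphism of ordered groups from (k, +) onto the positive elements of k. *)
Definition exponential (k : rcfType) (exp : k -> k) :=
  [/\ set_bij [set: k] [set y | 0 < y] exp,
      {morph exp : x y / x + y >-> x * y}
    & {mono exp : x y / x < y}].

Definition omega_map (k : rcfType) (d' : Order.disp_t) (G : ordAbGroupType d')
    (d : Order.disp_t) (kappa : regCardType d) (omega : hahn k G kappa -> G) :=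
  [/\ bijective omega,
      {morph omega : x y / x + y >-> (x * y)%g}
    & {mono omega : x y / x < y >-> (x < y)%O}].

(* Main.v *)
Require Import Defs.
From HB Require Import structures.
From mathcomp Require Import all_boot all_order all_algebra.
From mathcomp Require Import boolp classical_sets functions.
From mathcomp Require Import lra.

(** As an ordered group, the additive group of k((G))_kappa depends only on the
    chain G: it is the group H(G) of functions G -> k with reverse well-ordered
    support of order type < kappa, ordered lexicographically. So it is enough
    to find a chain C and an isomorphism of chains H(C) -> C: then G := H(C)
    is isomorphic to C as a chain, hence H(G) is isomorphic to H(C) = G.

    Such a C is cut out of any chain U with a strictly increasing map
    code : H(U) -> U, as the least C included in U such that code f is in C
    whenever the support of f is included in C; minimality makes the
    restriction H(C) -> C surjective. For U we take the well-founded trees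
    whose nodes are kappa-sequences of optional pairs (coefficient, subtree):
    a series is coded by the enumeration of its terms in decreasing order, and
    the order of series becomes a lexicographic order on trees. *)

Set Implicit Arguments.
Unset Strict Implicit.
Unset Printing Implicit Defensive.

Import Order.TTheory GRing.Theory Num.Theory.

Local Open Scope classical_set_scope.
Local Open Scope ring_scope.

(** * Lexicographic order of series *)

Section Lexicographic.
Context {k : rcfType} {du : Order.disp_t} {U : orderType du}.
Implicit Types f g h : U -> k.

Definition supp f : set U := [set u | f u != 0].

Definition lex_lt f g :=
  exists2 u, f u < g u & forall v, (u < v)%O -> f v = g v.

Lemma lex_lt_irr f : ~ lex_lt f f.
Proof. by case=> u; rewrite ltxx. Qed.

Lemma lex_lt_trans f g h : lex_lt f g -> lex_lt g h -> lex_lt f h.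
Proof.
move=> [u fg fgE] [v gh ghE]; case: (ltgtP u v) => [uv|vu|uv].
- exists v => [|w vw]; first by rewrite fgE.
  by rewrite fgE ?ghE // (lt_trans uv).
- exists u => [|w uw]; first by rewrite -ghE.
  by rewrite fgE ?ghE // (lt_trans vu).
- subst v; exists u => [|w uw]; first exact: lt_trans gh.
  by rewrite fgE ?ghE.
Qed.

(** The points where [f] and [g] differ lie in the union of the two supports, so there is a largest
    one, and the values there decide. *)
Lemma lex_lt_total f g :
  rev_well_ordered (supp f) -> rev_well_ordered (supp g) ->
  [\/ f = g, lex_lt f g | lex_lt g f].
Proof.
move=> wf wg; have [fg|nfg] := pselect (f = g); first by constructor 1.
have [||u /eqP fgu umax] := (rev_well_orderedU wf wg) [set u | f u != g u].
- move=> u /= fgu; rewrite /supp /setU /=; have [f0|] := eqVneq (f u) 0; last by left.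
  by right; rewrite eq_sym -f0.
- apply: contrapT => /forallNP no; apply: nfg; apply/funext => u.
  by have /negP := no u; rewrite negbK => /eqP.
have E v : (u < v)%O -> f v = g v.
  move=> uv; apply/eqP; rewrite -[_ == _]negbK; apply/negP => /umax.
  by rewrite leNgt uv.
case: (ltgtP (f u) (g u)) => // lt; [constructor 2|constructor 3]; exists u => //.
by move=> v /E.
Qed.

End Lexicographic.

(** Lets the condition on supports be carried along a chain embedding, in both directions, when
    monomials are relabelled. *)
Lemma rev_otype_lt_image {d1 d2 : Order.disp_t} {T : orderType d1}
    {U : orderType d2} {d : Order.disp_t} (kappa : regCardType d)
    (e : T -> U) (S : set T) : {homo e : x y / (x < y)%O} ->
  rev_otype_lt kappa (e @` S) <-> rev_otype_lt kappa S.
Proof.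
move=> eh; have em := le_mono eh; have eltE := leW_mono em.
split=> [[a [h [[hS hinj hsurj] hE]]]|oS].
  exists a, (h \o e); split; last first.
    by move=> x y Sx Sy /=; rewrite hE ?eltE //; apply: imageP.
  split=> [x Sx|x y|b /hsurj[_ [x Sx <-] <-]].
  - by apply: hS; apply: imageP.
  - rewrite !inE => Sx Sy /= hxy; apply: (inc_inj em).
    by apply: hinj; rewrite ?inE //; apply: imageP.
  - by exists x.
(* Enumerating the image directly would need an inverse of [e]; reverse well-ordering and
   boundedness in [kappa] transfer without one. *)
apply: rev_otype_ltI => [A AS [_ /[dup] /AS[x Sx <-] Aex]|h].
  have [y [Sy Aey] ymax] := (rev_otype_lt_wo oS) [set x | S x /\ A (e x)]
    (fun _ => @proj1 _ _) (ex_intro _ x (conj Sx Aex)).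
  exists (e y) => // _ /[dup] /AS[z Sz <-] Aez; rewrite em.
  exact: ymax.
have [c hc] := rev_otype_lt_kbounded oS (h \o e).
by exists c => _ [x Sx <-]; apply: hc.
Qed.

(* The group of the series with support in C, written multiplicatively. *)
Section HahnGroup.
Context (k : rcfType) {du : Order.disp_t} {U : orderType du}.
Context {d : Order.disp_t} (kappa : regCardType d) (C : set U).

Definition hgroup_pred : {pred U -> k} :=
  fun f => `[< rev_otype_lt kappa (supp f) /\ supp f `<=` C >].

Record hgroup := HGroup { hgfun :> U -> k ; _ : hgfun \in hgroup_pred }.

HB.instance Definition _ := [isSub for hgfun].
HB.instance Definition _ := [Choice of hgroup by <:].

Fact hgroup_zmod_closed : zmod_closed hgroup_pred.
Proof.
split=> [|f g /asboolP[of_ fC] /asboolP[og gC]]; apply/asboolP.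
  have supp0 : supp (0 : U -> k) `<=` set0 by move=> u /=; rewrite /supp /= eqxx.
  split; first exact: rev_otype_lt_sub supp0 (rev_otype_lt0 _).
  by apply: subset_trans supp0 _.
have suppB : supp (f - g) `<=` supp f `|` supp g.
  move=> u; rewrite /supp /=; have [f0|] := eqVneq (f u) 0; last by left.
  by move=> fg; right; move: fg; rewrite -[_ u]/(f u - g u) f0 add0r oppr_eq0.
split; first exact: rev_otype_lt_sub suppB (rev_otype_ltU of_ og).
by move=> u /suppB[/fC|/gC].
Qed.

HB.instance Definition _ := GRing.isZmodClosed.Build _ _ hgroup_zmod_closed.
HB.instance Definition _ := [SubChoice_isSubZmodule of hgroup by <:].

HB.instance Definition _ := isGroup.Build hgroup
  (@addrA hgroup) (@add0r hgroup) (@addr0 hgroup) (@addNr hgroup) (@addrN hgroup).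

Lemma hgroup_otype (x : hgroup) : rev_otype_lt kappa (supp x).
Proof. by case: x => f /= /asboolP[]. Qed.

Lemma hgroup_supp (x : hgroup) : supp x `<=` C.
Proof. by case: x => f /= /asboolP[]. Qed.

Lemma hgroupM (x y : hgroup) u : (x * y)%g u = x u + y u. Proof. by []. Qed.

Lemma hgroupP (x y : hgroup) : (x : U -> k) = y -> x = y.
Proof. exact: val_inj. Qed.

Definition hgroup_lt : rel hgroup := fun x y => `[< lex_lt x y >].

Fact hgroup_lt_irr : irreflexive hgroup_lt.
Proof. by move=> x; apply/negbTE/asboolP; apply: lex_lt_irr. Qed.

Fact hgroup_lt_trans : transitive hgroup_lt.
Proof.
by move=> y x z /asboolP xy /asboolP yz; apply/asboolP; apply: lex_lt_trans yz.
Qed.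

HB.instance Definition _ :=
  Order.Lt_isPOrder.Build ring_display hgroup hgroup_lt_irr hgroup_lt_trans.

Lemma hgroup_ltE (x y : hgroup) : (x < y) = `[< lex_lt x y >].
Proof. by []. Qed.

Fact hgroup_le_total : total (<=%R : rel hgroup).
Proof.
move=> x y; rewrite !le_eqVlt !hgroup_ltE.
have [/hgroupP->|xy|yx] := lex_lt_total (rev_otype_lt_wo (hgroup_otype x))
  (rev_otype_lt_wo (hgroup_otype y)); first by rewrite eqxx.
  by apply/orP; left; apply/orP; right; apply/asboolP.
by apply/orP; right; apply/orP; right; apply/asboolP.
Qed.

HB.instance Definition _ :=
  Order.POrder_isTotal.Build ring_display hgroup hgroup_le_total.

Fact hgroup_mulC (x y : hgroup) : (x * y = y * x)%g.
Proof. exact: addrC. Qed.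

Fact hgroup_ltM2l (x y z : hgroup) :
  (y < z)%O -> ((x * y)%g < (x * z)%g)%O.
Proof.
move=> /asboolP[u lt E]; apply/asboolP; exists u; rewrite ?hgroupM ?ltrD2l //.
by move=> v /E yz; rewrite !hgroupM yz.
Qed.

HB.instance Definition _ :=
  isOrderedAbelian.Build ring_display hgroup hgroup_mulC hgroup_ltM2l.

End HahnGroup.

Lemma hahn_lt_lex (k : rcfType) (d' : Order.disp_t) (G : ordAbGroupType d')
    (d : Order.disp_t) (kappa : regCardType d) (x y : hahn k G kappa) :
  x < y <-> lex_lt x y.
Proof.
rewrite hahn_ltE; split=> [/asboolP[g]|[g lt E]].
  rewrite hahnD hahnN subr_gt0 => lt E; exists g => // h /E/eqP.
  by rewrite hahnD hahnN subr_eq0 => /eqP.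
apply/asboolP; exists g; first by rewrite hahnD hahnN subr_gt0.
by move=> h /E e; rewrite hahnD hahnN e subrr.
Qed.

(** * From a chain isomorphism onto [C] to an omega-map *)

Section OmegaOfChainIso.
Context (k : rcfType) {du : Order.disp_t} {U : orderType du}.
Context {d : Order.disp_t} (kappa : regCardType d) (C : set U).
Local Notation G := (hgroup k kappa C).
Variable e : G -> U.
Hypothesis e_homo : {homo e : x y / (x < y)%O}.
Hypothesis e_in : forall g, C (e g).
Hypothesis e_surj : forall u, C u -> exists g, e g = u.

Let e_lt : {mono e : x y / (x < y)%O} := leW_mono (le_mono e_homo).
Let e_inj : injective e := inc_inj (le_mono e_homo).

(** Relabels monomials along [e]: this is [x] composed with the inverse of [e], extended by 0
    outside [C]. *)
Definition transport (x : G -> k) (u : U) : k :=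
  if pselect (exists g, e g = u) is left E then x (sval (cid E)) else 0.

Lemma transportE x g : transport x (e g) = x g.
Proof.
rewrite /transport; case: pselect => [E|[]]; last by exists g.
by case: cid => h /= /e_inj->.
Qed.

Lemma transport_out x u : ~ C u -> transport x u = 0.
Proof.
by rewrite /transport; case: pselect => // -[g ge] []; rewrite -ge.
Qed.

Fact transport_subproof (x : hahn k G kappa) :
  transport x \in hgroup_pred kappa C.
Proof.
have sC : supp (transport x) `<=` C.
  by move=> u /eqP nz; apply: contrapT => /(transport_out x).
apply/asboolP; split=> //.
have -> : supp (transport x) = e @` hahn_supp x.
  apply/seteqP; split=> [u /[dup] /sC/e_surj[g <-]|_ [g xg <-]].
    by rewrite /supp /= transportE; exists g.
  by rewrite /supp /= transportE.
by apply/rev_otype_lt_image => //; case: x {sC} => f /= /asboolP.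
Qed.

Definition chain_omega (x : hahn k G kappa) : G := HGroup (transport_subproof x).

Fact chain_omega_inv_subproof (f : G) : (f \o e) \in hahn_pred kappa.
Proof.
apply/asboolP/(rev_otype_lt_image _ _ e_homo).
suff -> : e @` hahn_supp (f \o e) = supp f by exact: hgroup_otype.
apply/seteqP; split=> [_ [g fg <-] //|u /[dup] /hgroup_supp/e_surj[g <-]].
by exists g.
Qed.

Definition chain_omega_inv (f : G) : hahn k G kappa :=
  Hahn (chain_omega_inv_subproof f).

Lemma chain_omega_map : omega_map chain_omega.
Proof.
split.
- exists chain_omega_inv => [x|f].
    by apply: hahnP => g /=; rewrite transportE.
  apply: hgroupP; apply/funext => u /=.
  have [/e_surj[g <-]|nC] := pselect (C u); first by rewrite transportE.
  rewrite transport_out //; apply/esym/eqP; rewrite -[_ == _]negbK.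
  by apply/negP => /(@hgroup_supp _ _ _ _ _ _ f).
- move=> x y; apply: hgroupP; apply/funext => u; rewrite hgroupM /=.
  have [/e_surj[g <-]|nC] := pselect (C u); first by rewrite !transportE.
  by rewrite !transport_out // addr0.
- apply/leW_mono/le_mono => x y /hahn_lt_lex[g lt E].
  apply/asboolP; exists (e g) => [|u]; rewrite /= ?transportE //.
  have [/e_surj[h <-]|nC _] := pselect (C u); last by rewrite !transport_out.
  by rewrite e_lt !transportE => /E.
Qed.

End OmegaOfChainIso.

(** * The least set closed under coding *)

Section LeastFixedPoint.
Context (k : rcfType) {du : Order.disp_t} {U : orderType du}.
Context {d : Order.disp_t} (kappa : regCardType d) (code : (U -> k) -> U).
Hypothesis code_lt : forall f g : U -> k,
  rev_otype_lt kappa (supp f) -> rev_otype_lt kappa (supp g) ->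
  lex_lt f g -> (code f < code g)%O.

Definition code_closed (A : set U) := forall f : U -> k,
  rev_otype_lt kappa (supp f) -> supp f `<=` A -> A (code f).

Definition hereditary : set U :=
  [set u | forall A : set U, code_closed A -> A u].

Lemma hereditary_closed : code_closed hereditary.
Proof. by move=> f of_ fH A Acl; apply: (Acl) => // u /fH; apply. Qed.

(** The hereditary elements of the required form are themselves a closed set, so by minimality they
    are all the hereditary elements. *)
Lemma hereditaryP u : hereditary u ->
  exists f : U -> k,
    [/\ rev_otype_lt kappa (supp f), supp f `<=` hereditary & code f = u].
Proof.
pose A := [set u | hereditary u /\ exists f : U -> k,
  [/\ rev_otype_lt kappa (supp f), supp f `<=` hereditary & code f = u]].
move=> /(_ A)[]// f of_ fA; have fH : supp f `<=` hereditary by move=> v /fA[].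
by split; [apply: hereditary_closed|exists f].
Qed.

(* By minimality, code is an isomorphism of chains from the group of the series
   with hereditary support onto the hereditary elements. *)
Lemma omega_of_code : exists (d' : Order.disp_t) (G : ordAbGroupType d')
  (omega : hahn k G kappa -> G), omega_map omega.
Proof.
pose G := hgroup k kappa hereditary; pose e (x : G) := code x.
have e_homo : {homo e : x y / (x < y)%O}.
  by move=> x y /asboolP; apply: code_lt; apply: hgroup_otype.
have e_in x : hereditary (e x).
  by apply: hereditary_closed; [apply: hgroup_otype|apply: hgroup_supp].
have e_surj u : hereditary u -> exists x, e x = u.
  move=> /hereditaryP[f [of_ fH <-]].
  have fG : f \in hgroup_pred kappa hereditary by apply/asboolP.
  by exists (HGroup fG).
by exists ring_display, G; exists (chain_omega e_homo e_in e_surj);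
  apply: chain_omega_map.
Qed.

End LeastFixedPoint.

(** * Well-founded trees and their order *)

Section Trees.
Context {d : Order.disp_t} (kappa : regCardType d) (k : rcfType).

Inductive tree := Node of (kappa -> option (k * tree)).

Lemma tree_nested_ind (P : tree -> Prop) :
  (forall s, (forall i r u, s i = Some (r, u) -> P u) -> P (Node s)) ->
  forall t, P t.
Proof.
(* Matching on [s i] replaces [u] by the visible subterm [u'], which makes the recursive call
   guarded. *)
move=> H; fix IH 1 => -[s]; apply: H => i r u; case: (s i) => [[r' u'] [_ <-]|].
  exact: IH.
discriminate.
Qed.

(* An entry (r, u) stands for the leading term u r of what remains of a series
   and None for an empty remainder; entries are ordered as these remainders. *)
Inductive tree_lt : tree -> tree -> Prop :=
| tree_lt_Node s t i of (forall j, (j < i)%O -> s j = t j)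
    & entry_lt (s i) (t i) : tree_lt (Node s) (Node t)
with entry_lt : option (k * tree) -> option (k * tree) -> Prop :=
| entry_lt_None_pos (r : k) u of 0 <= r : entry_lt None (Some (r, u))
| entry_lt_neg_None (r : k) u of r < 0 : entry_lt (Some (r, u)) None
| entry_lt_neg_pos (r : k) u (r' : k) u' of r < 0 & 0 <= r' :
    entry_lt (Some (r, u)) (Some (r', u'))
| entry_lt_coef (r r' : k) u of r < r' : entry_lt (Some (r, u)) (Some (r', u))
| entry_lt_pos (r : k) u (r' : k) u' of 0 <= r & 0 <= r' & tree_lt u u' :
    entry_lt (Some (r, u)) (Some (r', u'))
| entry_lt_neg (r : k) u (r' : k) u' of r < 0 & r' < 0 & tree_lt u' u :
    entry_lt (Some (r, u)) (Some (r', u')).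


Lemma tree_ltP s t : tree_lt (Node s) (Node t) <->
  exists2 i, (forall j, (j < i)%O -> s j = t j) & entry_lt (s i) (t i).
Proof.
split=> [lt|[i E lt]]; last exact: tree_lt_Node E lt.
by inversion lt as [s' t' i E lt' es et]; subst; exists i.
Qed.

Lemma entry_lt_irr a :
  (forall r u, a = Some (r, u) -> ~ tree_lt u u) -> ~ entry_lt a a.
Proof.
move=> H lt; inversion lt as [| |r u r' u' r0 r'0|r r' u rr'|r u r' u' _ _ uu
  |r u r' u' _ _ uu]; subst; try exact: H uu.
  by move: r'0; rewrite leNgt r0.
by move: rr'; rewrite ltxx.
Qed.

Local Ltac split_signs := repeat match goal with
  | |- context [Some (?r, _)] =>
    lazymatch goal with
    | _ : is_true (r < 0) |- _ => fail
    | _ : is_true (0 <= r) |- _ => fail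
    | _ => case: (ltP r 0) => ?
    end
  end.

Local Ltac entry_lt_tac := solve
  [ exfalso; lra
  | apply: entry_lt_None_pos; lra
  | apply: entry_lt_neg_None; lra
  | apply: entry_lt_neg_pos; lra
  | apply: entry_lt_coef; lra
  | apply: entry_lt_pos => //; eauto
  | apply: entry_lt_neg => //; eauto ].

(** Transitivity is assumed only through the subtree of the middle entry: [tree_lt_trans] supplies
    it by induction on the middle tree. *)
Lemma entry_lt_trans a b c :
  (forall r u, b = Some (r, u) ->
    forall x y, tree_lt x u -> tree_lt u y -> tree_lt x y) ->
  entry_lt a b -> entry_lt b c -> entry_lt a c.
Proof.
move=> H ab bc.
by inversion ab; subst; inversion bc; subst; split_signs; entry_lt_tac.
Qed.

(** Equal subtrees are compared by coefficients, distinct ones by signs first. Counting 0 as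
    nonnegative makes all entries comparable, although enumerations of series contain only nonzero
    coefficients. *)
Lemma entry_lt_total a b :
  (forall r u, a = Some (r, u) ->
    forall v, [\/ u = v, tree_lt u v | tree_lt v u]) ->
  [\/ a = b, entry_lt a b | entry_lt b a].
Proof.
case: a b => [[r u]|] [[r' u']|] H; last by constructor 1.
  have [->|uu'|u'u] := H _ _ erefl u'.
  have [rr'|r'r|->] := ltgtP r r'; last by constructor 1.
    by constructor 2; apply: entry_lt_coef.
  by constructor 3; apply: entry_lt_coef.
all: by split_signs; solve [constructor 2; entry_lt_tac
  | constructor 3; entry_lt_tac].
Qed.

Lemma tree_lt_irr u : ~ tree_lt u u.
Proof.
elim/tree_nested_ind: u => s IH /tree_ltP[i _].
by apply: entry_lt_irr => r u /IH.
Qed.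

Lemma tree_lt_trans u v w : tree_lt u v -> tree_lt v w -> tree_lt u w.
Proof.
elim/tree_nested_ind: v u w => t IH [s] [w].
move=> /tree_ltP[i stE st] /tree_ltP[j twE tw]; apply/tree_ltP.
case: (ltgtP i j) => [ij|ji|ij].
- exists i => [l li|]; last by rewrite -twE.
  by rewrite stE ?twE // (lt_trans li).
- exists j => [l lj|]; last by rewrite stE.
  by rewrite stE ?twE // (lt_trans lj).
- subst j; exists i => [l li|]; first by rewrite stE ?twE.
  by apply: entry_lt_trans st tw => r x /IH H y z; apply: H.
Qed.

Lemma tree_lt_total u v : [\/ u = v, tree_lt u v | tree_lt v u].
Proof.
elim/tree_nested_ind: u v => s IH [t].
have [->|st] := pselect (s = t); first by constructor 1.
have [|i sti imin] := @wo_min d kappa [set i | s i <> t i].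
  apply: contrapT => /forallNP no; apply: st; apply/funext => i.
  exact: contrapT (no i).
have E j : (j < i)%O -> s j = t j.
  by move=> ji; apply: contrapT => /imin; rewrite leNgt ji.
have [//|lt|lt] := @entry_lt_total (s i) (t i) (IH i).
  by constructor 2; apply/tree_ltP; exists i.
by constructor 3; apply/tree_ltP; exists i => // j /E.
Qed.

HB.instance Definition _ := gen_eqMixin tree.
HB.instance Definition _ := gen_choiceMixin tree.

Definition tree_ltb : rel tree := fun u v => `[< tree_lt u v >].

Fact tree_ltb_irr : irreflexive tree_ltb.
Proof. by move=> u; apply/negbTE/asboolP/tree_lt_irr. Qed.

Fact tree_ltb_trans : transitive tree_ltb.
Proof.
by move=> v u w /asboolP uv /asboolP vw; apply/asboolP; apply: tree_lt_trans vw.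
Qed.

HB.instance Definition _ :=
  Order.Lt_isPOrder.Build d tree tree_ltb_irr tree_ltb_trans.

Lemma tree_ltE (u v : tree) : (u < v)%O = `[< tree_lt u v >].
Proof. by []. Qed.

Fact tree_le_total : total (<=%O : rel tree).
Proof.
move=> u v; rewrite !le_eqVlt !tree_ltE.
have [->|uv|vu] := tree_lt_total u v; first by rewrite eqxx.
  by apply/orP; left; apply/orP; right; apply/asboolP.
by apply/orP; right; apply/orP; right; apply/asboolP.
Qed.

HB.instance Definition _ := Order.POrder_isTotal.Build d tree tree_le_total.

(** * Decreasing enumeration of the terms of a series *)

Definition above (u : tree) (a : option (k * tree)) : bool :=
  if a is Some (_, v) then (v < u)%O else true.

Lemma above_trans u v a : above u a -> (u < v)%O -> above v a.
Proof. by case: a => [[r w]|] //=; apply: lt_trans. Qed.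

(** The last field expresses both the decreasing order and the absence of gaps: each term above the
    [i]-th entry occurs before [i], and no term occurs after a [None]. *)
Record decreasing_enum (f : tree -> k) (s : kappa -> option (k * tree)) := {
  enum_coef : forall i r u, s i = Some (r, u) -> r != 0 /\ f u = r;
  enum_inj : forall i j r r' u, s i = Some (r, u) -> s j = Some (r', u) -> i = j;
  enum_surj : forall u, f u != 0 -> exists i, s i = Some (f u, u);
  enum_above : forall i u, f u != 0 -> above u (s i) ->
    exists2 j, (j < i)%O & s j = Some (f u, u) }.

Lemma decreasing_enum_exists f : rev_otype_lt kappa (supp f) ->
  exists s, decreasing_enum f s.
Proof.
move=> [a [h [[ha hinj hsurj] hE]]].
(* The isomorphism [h] of the support onto an initial segment of [kappa] is inverted; indices that
   it misses get [None]. *)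
pose s i := if pselect (exists u, supp f u /\ h u = i) is left E
  then Some (f (sval (cid E)), sval (cid E)) else None.
have sE u : supp f u -> s (h u) = Some (f u, u).
  move=> fu; rewrite /s; case: pselect => [E|[]]; last by exists u.
  by case: cid => v /= [fv hv]; rewrite (hinj v u) // inE.
have s_inv i r u : s i = Some (r, u) -> [/\ f u != 0, f u = r & h u = i].
  rewrite /s; case: pselect => // E; case: cid => v /= [fv hv] [fr vu].
  by rewrite -vu; split.
exists s; split.
- by move=> i r u /s_inv[fu <-].
- by move=> i j r r' u /s_inv[_ _ <-] /s_inv[].
- by move=> u fu; exists (h u); apply: sE.
- move=> i u fu ab; exists (h u); last exact: sE.
  move: ab; case si: (s i) => [[r v]|] /=.
    by have [fv _ <-] := s_inv _ _ _ si; rewrite hE.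
  (* A [None] at [i] means that [h] misses [i], so [a <= i], whereas [h u < a]. *)
  move=> _; apply: lt_le_trans (ha _ fu) _; rewrite leNgt; apply/negP.
  by move=> /hsurj[v fv hv]; move: si; rewrite -hv sE.
Qed.

(** * Comparison of series whose enumerations agree before an index *)

Section Compare.
Variables (f g : tree -> k) (s t : kappa -> option (k * tree)) (i : kappa).
Hypotheses (fs : decreasing_enum f s) (gt : decreasing_enum g t).
Hypothesis stE : forall j, (j < i)%O -> s j = t j.

(** A term above both [i]-th entries is listed before [i], where the two enumerations coincide. *)
Lemma enum_agree u : above u (s i) -> above u (t i) -> f u = g u.
Proof.
move=> us ut; have [f0|fu] := eqVneq (f u) 0; last first.
  have [j ji sj] := enum_above fs fu us.
  by move: sj; rewrite stE // => /(enum_coef gt)[].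
have [->//|gu] := eqVneq (g u) 0.
have [j ji tj] := enum_above gt gu ut.
by move: tj; rewrite -stE // => /(enum_coef fs)[].
Qed.

(** Otherwise [u] would be listed before [i] in [t], hence in [s], where it also occurs at [i]. *)
Lemma enum_fresh r u : s i = Some (r, u) -> above u (t i) -> g u = 0.
Proof.
move=> si ut; apply/eqP; rewrite -[_ == _]negbK; apply/negP => gu.
have [j ji tj] := enum_above gt gu ut.
by move: (ji); rewrite (enum_inj fs si (etrans (stE ji) tj)) ltxx.
Qed.

Lemma enum_lt_coef r r' u :
  s i = Some (r, u) -> t i = Some (r', u) -> r < r' -> lex_lt f g.
Proof.
move=> si ti rr'; have [_ fu] := enum_coef fs si; have [_ gu] := enum_coef gt ti.
exists u => [|v uv]; first by rewrite fu gu.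
by apply: enum_agree; rewrite ?si ?ti.
Qed.

Lemma enum_lt_neg r u :
  s i = Some (r, u) -> r < 0 -> above u (t i) -> lex_lt f g.
Proof.
move=> si r0 ut; have [_ fu] := enum_coef fs si.
exists u => [|v uv]; first by rewrite fu (enum_fresh si).
by apply: enum_agree; [rewrite si|apply: above_trans uv].
Qed.

End Compare.

(** Stated with its own hypotheses because [enum_fresh] is applied with the two series exchanged. *)
Lemma enum_lt_pos f g s t i r u :
  decreasing_enum f s -> decreasing_enum g t ->
  (forall j, (j < i)%O -> s j = t j) ->
  t i = Some (r, u) -> 0 <= r -> above u (s i) -> lex_lt f g.
Proof.
move=> fs gt stE ti r0 us; have [nr gu] := enum_coef gt ti.
have tsE j : (j < i)%O -> t j = s j by move=> /stE.
exists u => [|v uv]; first by rewrite gu (enum_fresh gt fs tsE ti) // lt_def nr.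
by apply: (enum_agree fs gt stE); [apply: above_trans uv|rewrite ti].
Qed.

Lemma enum_lt f g s t : decreasing_enum f s -> decreasing_enum g t ->
  tree_lt (Node s) (Node t) -> lex_lt f g.
Proof.
move=> fs gt /tree_ltP[i stE lt].
have lt_neg := enum_lt_neg fs gt stE; have lt_coef := enum_lt_coef fs gt stE.
have lt_pos := enum_lt_pos fs gt stE.
move esi: (s i) lt lt_neg lt_coef lt_pos => a; move eti: (t i) => b lt.
case: a b / lt esi eti => [r u r0|r u r0|r u r' u' r0 r'0|r r' u rr'|
  r u r' u' r0 r'0 /asboolP uu'|r u r' u' r0 r'0 /asboolP u'u]
  esi eti lt_neg lt_coef lt_pos.
- exact: lt_pos erefl r0 isT.
- exact: lt_neg erefl r0 isT.
(* Here the two subtrees are unrelated: the larger one decides, through a negative coefficient of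
   [f] or a positive one of [g]; if they coincide, the coefficients decide. *)
- case: (ltgtP u u') => [uu'|u'u|e].
  + exact: lt_pos erefl r'0 uu'.
  + exact: lt_neg erefl r0 u'u.
  + by apply: (lt_coef r r' u); rewrite ?e //; apply: lt_le_trans r'0.
- exact: lt_coef erefl erefl rr'.
- exact: lt_pos erefl r'0 uu'.
- exact: lt_neg erefl r0 u'u.
Qed.

(** Totality of the tree order reverses [enum_lt]: the opposite inequality would give a
    lexicographic cycle. *)
Lemma lt_enum f g s t : decreasing_enum f s -> decreasing_enum g t ->
  lex_lt f g -> tree_lt (Node s) (Node t).
Proof.
move=> fs gt fg; case: (tree_lt_total (Node s) (Node t)) => [[st]|//|lt].
(* One sequence enumerates both series, so they have the same value at every point. *)
- subst t; case: fg => u fgu _; exfalso; move: fgu.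
  have [f0|] := eqVneq (f u) 0.
    have [g0|] := eqVneq (g u) 0; first by rewrite f0 g0 ltxx.
    by move=> /(enum_surj gt)[i /(enum_coef fs)[_ ->]]; rewrite ltxx.
  by move=> /(enum_surj fs)[i /(enum_coef gt)[_ ->]]; rewrite ltxx.
- by case: (@lex_lt_irr _ _ _ f); apply: lex_lt_trans fg (enum_lt gt fs lt).
Qed.

Lemma tree_code_exists : exists code : (tree -> k) -> tree,
  forall f g, rev_otype_lt kappa (supp f) -> rev_otype_lt kappa (supp g) ->
  lex_lt f g -> (code f < code g)%O.
Proof.
have ex f : exists s, rev_otype_lt kappa (supp f) -> decreasing_enum f s.
  have [/decreasing_enum_exists[s fs]|no] := pselect (rev_otype_lt kappa (supp f)).
    by exists s.
  (* Arbitrary value for functions that are not series. *)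
  by exists (fun=> None).
have [s sP] := choice ex; exists (fun f => Node (s f)) => f g of_ og fg.
by apply/asboolP; apply: lt_enum fg; apply: sP.
Qed.

End Trees.

Theorem theorem3p2 (d : Order.disp_t) (kappa : regCardType d)
  (k : rcfType) (exp : k -> k) (hexp : exponential exp) :
  exists (d' : Order.disp_t) (G : ordAbGroupType d')
         (omega : hahn k G kappa -> G), omega_map omega.
Proof.
have [code code_lt] := @tree_code_exists d kappa k.
exact: omega_of_code code_lt.
Qed.
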